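(* Let $\alpha>0$, let $\beta>1$ be fixed, and let $\kappa\in(0,1)$, $\sigma^2>0$ satisfy $(\kappa,\sigma^2)\in R_\beta$, i.e. $$\frac{1}{\sigma^2(1+\beta/\sigma^2)^{1/\beta}}-\frac{1}{\sigma^2+\beta}<\frac{\kappa[(1-\kappa)\beta-1]}{\beta-1}.$$ For each $n$ let $\theta^\star=\theta^{\star,(n)}\in\mathbb{R}^n$ be $s_n$-sparse, where $s_n\to\infty$ and $s_n=o(n)$ as $n\to\infty$, and let $X=(X_1,\ldots,X_n)$ have independent coordinates $X_i\sim\mathsf{N}(\theta_i^\star,1)$. Put $\varepsilon_n=s_n\log(n/s_n)$ and $\delta_n=K\varepsilon_n n^{-1}$. Then, for every sufficiently large constant $K>0$, $$\mathsf{E}_{\theta^\star}\{\mathsf{P}(1-\omega>\delta_n\mid X)\}\to 0\quad\text{as }n\to\infty,$$ where $\mathsf{P}(\cdot\mid X)$ is the empirical Bayes posterior distribution of $(\theta,\omega)$ with parameters $(\alpha,\kappa,\sigma^2)$.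
   Context: $\mathsf{N}(\mu,v)$ is the normal distribution with mean $\mu$ and variance $v$. Sparsity. $\theta^\star\in\mathbb{R}^n$ (depending on $n$, deterministic) is called $s_n$-sparse if it has exactly $s_n$ non-zero coordinates. Model. For $\theta\in\mathbb{R}^n$, $p_\theta^n(x)=\prod_{i=1}^n (2\pi)^{-1/2}e^{-(x_i-\theta_i)^2/2}$ is the joint density of independent $X_i\sim\mathsf{N}(\theta_i,1)$, $i=1,\ldots,n$. $\mathsf{E}_{\theta^\star}$ denotes expectation over $X$ when the true mean vector is $\theta^\star$. Data-dependent prior (given $X$). $\tilde\Pi_X$ is the distribution of $(\theta,\omega)\in\mathbb{R}^n\times(0,1)$ under which $\omega\sim\mathsf{Beta}(\alpha n,1)$ (density $\alpha n\,\omega^{\alpha n-1}$ on $(0,1)$) and, given $\omega$, the $\theta_i$ are independent with $\theta_i\sim\omega\,\delta_0+(1-\omega)\,\mathsf{N}(X_i,\sigma^2)$, where $\delta_0$ is the point mass at $0$. Empirical Bayes posterior of $(\theta,\omega)$. For measurable $B\subseteq\mathbb{R}^n\times(0,1)$, $$\mathsf{P}((\theta,\omega)\in B\mid X)=\frac{\int_B p_\theta^n(X)^\kappa\,\tilde\Pi_X(d\theta,d\omega)}{\int_{\mathbb{R}^n\times(0,1)}p_\theta^n(X)^\kappa\,\tilde\Pi_X(d\theta,d\omega)}.$$ *)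

(* Defs.v *)
From HB Require Import structures.
From mathcomp Require Import all_boot all_order all_algebra.
From mathcomp Require Import all_classical all_reals all_analysis.
From mathcomp Require Import measurable_realfun.

Set Implicit Arguments.
Unset Strict Implicit.
Unset Printing Implicit Defensive.
Import Order.TTheory GRing.Theory Num.Theory.
Import numFieldNormedType.Exports.

Local Open Scope classical_set_scope.
Local Open Scope ring_scope.

Definition tuple_cons n (T : Type) (p : T * n.-tuple T) : n.+1.-tuple T :=
  [tuple of p.1 :: p.2].

Section tuple_cons_measurable.
Context d (T : measurableType d) (n : nat).

Lemma measurable_tuple_cons : measurable_fun [set: T * n.-tuple T] (@tuple_cons n T).
Proof. exact: measurable_cons. Qed.

HB.instance Definition _ :=
  isMeasurableFun.Build _ _ _ _ (@tuple_cons n T) measurable_tuple_cons.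

End tuple_cons_measurable.

(* The product measure of P_0, ..., P_(n-1) on the n-tuples, i.e. the law of
   a tuple of independent coordinates with marginals P_i. *)
Fixpoint prod_prob d (T : measurableType d) (R : realType) (n : nat) :
    ('I_n -> probability T R) -> probability (n.-tuple T) R :=
  match n with
  | 0 => fun _ => \d_([tuple] : 0.-tuple T)
  | n.+1 => fun P => distribution
      (P ord0 \x prod_prob (fun i => P (lift ord0 i)))%E (@tuple_cons n T)
  end.

Lemma prod_prob_box d (T : measurableType d) (R : realType) (n : nat)
    (P : 'I_n -> probability T R) (A : 'I_n -> set T) :
  (forall i, measurable (A i)) ->
  prod_prob P [set t | forall i, A i (tnth t i)] = (\prod_(i < n) P i (A i))%E.
Proof.
elim: n => [|n IH] in P A *; move=> mA.
  by rewrite /= big_ord0 /dirac indicE mem_set//= => -[].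
rewrite big_ord_recl -IH//= /distribution /pushforward.
rewrite -product_measure1E//; last first.
  rewrite [X in measurable X](_ : _ =
      \bigcap_(i in [set: 'I_n]) ((@tnth n T ^~ i) @^-1` A (lift ord0 i))); last first.
    by apply/seteqP; split => t h i => [_|]; exact: h.
  apply: fin_bigcap_measurable => // i _; rewrite -[X in measurable X]setTI.
  exact: measurable_tnth.
congr (_ _); apply/seteqP; split=> [[x t]/= h|[x t]/= [h0 h] i].
- split; first by have := h ord0; rewrite tnth0.
  by move=> i; have := h (lift ord0 i); rewrite tnthS.
- by case: (unliftP ord0 i) => [j ->|->]; rewrite ?tnth0 ?tnthS.
Qed.

Section prob_family.
Context d d' (T : measurableType d) (Y : measurableType d') (R : realType).

Definition prob_family (k : T -> probability Y R)
  (mk : forall U, measurable U -> measurable_fun [set: T] (fun t => k t U)) :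
  T -> {measure set Y -> \bar R} := k.

Variables (k : T -> probability Y R)
  (mk : forall U, measurable U -> measurable_fun [set: T] (fun t => k t U)).

HB.instance Definition _ := isKernel.Build _ _ _ _ _ (prob_family mk) mk.

Let prob_family_setT x : prob_family mk x [set: Y] = 1%E.
Proof. exact: probability_setT. Qed.

HB.instance Definition _ :=
  Kernel_isProbability.Build _ _ _ _ _ (prob_family mk) prob_family_setT.

End prob_family.

Lemma measurable_prob_xsection d d' (T : measurableType d)
    (Y : measurableType d') (R : realType) (k : T -> probability Y R)
    (A : set (T * Y)) :
  (forall U, measurable U -> measurable_fun [set: T] (fun t => k t U)) ->
  measurable A -> measurable_fun [set: T] (fun t => k t (xsection A t)).
Proof.
move=> mk mA.
have := @measurable_fun_xsection_finite_kernel _ _ _ _ _ (prob_family mk) A.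
by apply; rewrite inE.
Qed.

Lemma measurable_prob_ysection d d' (T : measurableType d)
    (Y : measurableType d') (R : realType) (k : T -> probability Y R)
    (B : set (Y * T)) :
  (forall U, measurable U -> measurable_fun [set: T] (fun t => k t U)) ->
  measurable B -> measurable_fun [set: T] (fun t => k t (ysection B t)).
Proof.
move=> mk mB; have mA : measurable ((fun z : T * Y => (z.2, z.1)) @^-1` B).
  have mf : measurable_fun setT (fun z : T * Y => (z.2, z.1)).
    exact: measurable_fun_pair.
  by rewrite -[X in measurable X]setTI; exact: mf.
exact: (measurable_prob_xsection mk mA).
Qed.

Lemma measurable_prod_prob d d' (T : measurableType d) (Y : measurableType d')
    (R : realType) (n : nat) (k : T -> 'I_n -> probability Y R) (U : set (n.-tuple Y)) :
  (forall i V, measurable V -> measurable_fun [set: T] (fun t => k t i V)) ->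
  measurable U -> measurable_fun [set: T] (fun t => prod_prob (k t) U).
Proof.
elim: n => [|n IH] in k U *; move=> mk mU; first exact: measurable_cst.
pose A := @tuple_cons n Y @^-1` U.
have mA : measurable A.
  by rewrite -[X in measurable X]setTI; exact: measurable_tuple_cons.
pose m0 := mk ord0.
rewrite [X in measurable_fun _ X](_ : _ = fun t =>
  (\int[prob_family m0 t]_y
    prod_prob (fun i => k (t, y).1 (lift ord0 i)) (xsection A (t, y).2))%E)//.
pose K (p : T * Y) := prod_prob (fun i => k p.1 (lift ord0 i)).
pose A' := [set z : (T * Y) * n.-tuple Y | A (z.1.2, z.2)].
have mA' : measurable A'.
  have mf : measurable_fun setT (fun z : (T * Y) * n.-tuple Y => (z.1.2, z.2)).
    apply: measurable_fun_pair => //=.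
    by apply: (measurableT_comp measurable_snd); exact: measurable_fst.
  by rewrite -[X in measurable X]setTI; exact: mf.
have AA' p : xsection A p.2 = xsection A' p.
  by apply/seteqP; split => z; rewrite /xsection/= !inE.
have mK V : measurable V -> measurable_fun [set: T * Y] (fun p => K p V).
  move=> mV; rewrite /K.
  apply: (measurableT_comp (f := fun t => prod_prob (fun i => k t (lift ord0 i)) V)) => //.
  exact: (IH _ V (fun i => mk (lift ord0 i))).
apply: (@measurable_fun_integral_finite_kernel _ _ _ _ _
  (fun p : T * Y => K p (xsection A p.2)) (prob_family m0)) => //.
under eq_fun do rewrite AA'.
exact: measurable_prob_xsection.
Qed.

Section beta1.
Context {R : realType}.
Local Notation mu := (@lebesgue_measure R).

(* Density of Beta(a, 1) for a real parameter a > 0 (beta_prob only has integer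
   parameters); the value for a <= 0 is a dummy, the uniform density. *)
Definition beta1_pdf (a x : R) : R :=
  (if 0 < a then a * x `^ (a - 1) else 1) * \1_(`]0, 1[ : set R) x.

Lemma beta1_pdf_ge0 a x : 0 <= beta1_pdf a x.
Proof.
rewrite /beta1_pdf mulr_ge0//; case: ifPn => // a0.
by rewrite mulr_ge0 ?powR_ge0// ltW.
Qed.

Lemma measurable_beta1_pdf a : measurable_fun [set: R] (beta1_pdf a).
Proof.
apply: measurable_funM; last exact: measurable_indic.
have [_|_] := boolP (0 < a); last exact: measurable_cst.
by apply: measurable_funM => //; exact: measurable_powR.
Qed.

Lemma integral_powR01 (a : R) : 0 < a ->
  (\int[mu]_(x in `]0%R, 1%R]) (a * x `^ (a - 1))%:E = 1)%E.
Proof.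
move=> a0.
pose F (k : nat) : set R := `[k.+2%:R^-1, 1]%classic.
have Fcvg : (\int[mu]_(x in F k) (a * x `^ (a - 1))%:E)%E @[k --> \oo] -->
    (\int[mu]_(x in \bigcup_k F k) (a * x `^ (a - 1))%:E)%E.
  apply: ge0_nondecreasing_set_cvg_integral.
  - apply/nondecreasing_seqP => k; rewrite subsetEset => x.
    rewrite /F/= !in_itv/= => /andP[h ->]; rewrite andbT (le_trans _ h)//.
    by rewrite lef_pV2 ?posrE// ler_nat.
  - by move=> k; exact: measurable_itv.
  - move=> k; apply/measurable_EFinP/measurable_funTS.
    by apply: measurable_funM => //; exact: measurable_powR.
  - by move=> k x _; rewrite lee_fin mulr_ge0 ?powR_ge0// ltW.
have FE : \bigcup_k F k = `]0%R, 1%R]%classic.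
  apply/seteqP; split => x /=.
    move=> [k _]; rewrite /F/= !in_itv/= => /andP[kx ->]; rewrite andbT.
    by rewrite (lt_le_trans _ kx).
  rewrite in_itv/= => /andP[x0 x1].
  exists (Num.bound x^-1) => //; rewrite /F/= in_itv/= x1 andbT.
  rewrite invf_ple ?posrE// (le_trans (ltW (archi_boundP _)))//.
    by rewrite invr_ge0 ltW.
  by rewrite ler_nat -addn2 leq_addr.
rewrite FE in Fcvg.
apply: cvg_unique Fcvg _ => //.
have FkE k : (\int[mu]_(x in F k) (a * x `^ (a - 1))%:E =
    (1 - (k.+2%:R^-1) `^ a)%:E)%E.
  have k0 : (0 : R) < k.+2%:R^-1 by [].
  have k1 : k.+2%:R^-1 < (1 : R) by rewrite invf_lt1// ltr1n.
  have powRc b : {within `[k.+2%:R^-1, 1], continuous (fun x : R => x `^ b)}.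
    apply: derivable_within_continuous => x; rewrite in_itv/= => /andP[kx _].
    by apply: ex_derive; apply: is_derive1_powR; exact: lt_le_trans kx.
  rewrite (@continuous_FTC2 _ _ (fun x => x `^ a))//.
  - by rewrite powR1 EFinB.
  - apply: derivable_within_continuous => x; rewrite in_itv/= => /andP[kx _].
    apply: derivableM => //; apply: ex_derive; apply: is_derive1_powR.
    exact: lt_le_trans kx.
  - have /continuous_within_itvP-/(_ k1)[_ h0 h1] := powRc a.
    split => // x; rewrite in_itv/= => /andP[kx _].
    by apply: ex_derive; apply: is_derive1_powR; exact: lt_trans kx.
  - move=> x; rewrite in_itv/= => /andP[kx _].
    by rewrite powR_derive1// in_itv/= andbT (lt_trans _ kx).
rewrite /= (eq_cvg _ _ FkE); apply: cvg_EFin; first exact: nearW.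
rewrite -[X in _ --> X]subr0; apply: cvgB; first exact: cvg_cst.
apply: (cvg_at_rightP (fun x => x `^ a) 0 0).1; first exact: powR_cvg0.
split => //; have := @cvg_harmonic R; rewrite -cvg_shiftS; exact: cvg_trans.
Qed.

Definition beta1_prob (a : R) (A : set R) : \bar R :=
  (\int[mu]_(x in A) (beta1_pdf a x)%:E)%E.

Lemma integral_beta1_pdf a : (\int[mu]_x (beta1_pdf a x)%:E = 1)%E.
Proof.
transitivity (\int[mu]_(x in `]0%R, 1%R[)
    (if 0 < a then a * x `^ (a - 1) else 1)%:E)%E.
  rewrite [RHS]integral_mkcond; apply: eq_integral => x _.
  rewrite /beta1_pdf patchE indicE.
  by case: (x \in `]0%R, 1%R[%classic); rewrite ?mulr1 ?mulr0.
rewrite integral_itv_bndo_bndc; last first.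
  apply/measurable_EFinP/measurable_funTS.
  have [_|_] := boolP (0 < a); last exact: measurable_cst.
  by apply: measurable_funM => //; exact: measurable_powR.
have [a0|_] := boolP (0 < a); first exact: integral_powR01.
by rewrite integral_cst//= lebesgue_measure_itv/= lte01 mul1e oppr0 adde0.
Qed.

Variable a : R.

Let beta1_prob0 : beta1_prob a set0 = 0%E.
Proof. exact: integral_set0. Qed.

Let beta1_prob_ge0 A : (0 <= beta1_prob a A)%E.
Proof. by apply: integral_ge0 => x _; rewrite lee_fin beta1_pdf_ge0. Qed.

Let beta1_prob_sigma_additive : semi_sigma_additive (beta1_prob a).
Proof.
move=> A mA tA mUA.
rewrite /beta1_prob ge0_integral_bigcup//=.
- apply: is_cvg_ereal_nneg_natsum_cond => n _ _.
  by apply: integral_ge0 => /= x ?; rewrite lee_fin beta1_pdf_ge0.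
- by apply/measurable_funTS/measurable_EFinP; exact: measurable_beta1_pdf.
- by move=> x _; rewrite lee_fin beta1_pdf_ge0.
Qed.

HB.instance Definition _ := isMeasure.Build _ _ _ (beta1_prob a)
  beta1_prob0 beta1_prob_ge0 beta1_prob_sigma_additive.

Let beta1_prob_setT : beta1_prob a [set: R] = 1%E.
Proof. exact: integral_beta1_pdf. Qed.

HB.instance Definition _ :=
  @Measure_isProbability.Build _ _ R (beta1_prob a) beta1_prob_setT.

End beta1.

Section normal_law.
Context {R : realType} (m sigma : R).

(* normal_prob, transported to the default measurable structure of R;
   sigma is the standard deviation. *)
Definition normal_law : set R -> \bar R := normal_prob m sigma.

Let normal_law0 : normal_law set0 = 0%E.
Proof. exact: measure0. Qed.

Let normal_law_ge0 A : (0 <= normal_law A)%E.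
Proof. exact: measure_ge0. Qed.

Let normal_law_sigma_additive : semi_sigma_additive normal_law.
Proof. exact: (@measure_semi_sigma_additive _ _ _ (normal_prob m sigma)). Qed.

HB.instance Definition _ := isMeasure.Build _ _ _ normal_law
  normal_law0 normal_law_ge0 normal_law_sigma_additive.

Let normal_law_setT : normal_law [set: R] = 1%E.
Proof. exact: (@probability_setT _ _ _ (normal_prob m sigma)). Qed.

HB.instance Definition _ :=
  @Measure_isProbability.Build _ _ R normal_law normal_law_setT.

End normal_law.

Section spike_slab.
Context {R : realType}.
Local Open Scope ereal_scope.

(* w delta_0 + (1 - w) N(x, sigma^2); the value for w outside [0, 1] is a dummy. *)
Definition spike_slab (sigma x w : R) (A : set R) : \bar R :=
  if (0 <= w <= 1)%R then
    w%:E * \d_(0%R : R) A + (1 - w)%:E * normal_law x sigma A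
  else \d_(0%R : R) A.

Lemma measurable_spike_slab sigma x A : measurable A ->
  measurable_fun [set: R] (fun w => spike_slab sigma x w A).
Proof.
move=> mA; apply: measurable_fun_ifT => /=.
- apply: measurable_and; exact: measurable_fun_ler.
- apply: emeasurable_funD; apply: emeasurable_funM => //;
    apply/measurable_EFinP => //.
  exact: measurable_funB.
- exact: measurable_cst.
Qed.

Variables sigma x w : R.

Let spike_slab0 : spike_slab sigma x w set0 = 0.
Proof. by rewrite /spike_slab !measure0 !mule0 adde0 if_same. Qed.

Let spike_slab_ge0 A : 0 <= spike_slab sigma x w A.
Proof.
rewrite /spike_slab; case: ifPn => [/andP[w0 w1]|_]; last exact: measure_ge0.
by rewrite adde_ge0// mule_ge0// lee_fin subr_ge0.
Qed.

Let spike_slab_sigma_additive : semi_sigma_additive (spike_slab sigma x w).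
Proof.
rewrite /spike_slab.
have [/andP[w0 w1]|_] := boolP (0 <= w <= 1)%R; last first.
  exact: measure_semi_sigma_additive.
have w1' : (0 <= 1 - w)%R by rewrite subr_ge0.
pose m := measure_add (mscale (NngNum w0) (\d_(0%R : R)))
                      (mscale (NngNum w1') (normal_law x sigma)).
rewrite (_ : (fun A => _) = m); first exact: measure_semi_sigma_additive.
by apply/funext => A; rewrite /m measure_addE.
Qed.

HB.instance Definition _ := isMeasure.Build _ _ _ (spike_slab sigma x w)
  spike_slab0 spike_slab_ge0 spike_slab_sigma_additive.

Let spike_slab_setT : spike_slab sigma x w [set: R] = 1.
Proof.
rewrite /spike_slab !probability_setT; case: ifPn => // _.
by rewrite !mule1 -EFinD addrC subrK.
Qed.

HB.instance Definition _ :=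
  @Measure_isProbability.Build _ _ R (spike_slab sigma x w) spike_slab_setT.

End spike_slab.

Section prior.
Context {R : realType} (n : nat).
Local Open Scope ereal_scope.

(* The joint law of (theta, omega), disintegrated along omega. The second
   coordinate ranges over R, but its law is carried by (0, 1). *)
Definition prior (alpha sigma : R) (x : n.-tuple R) (B : set (n.-tuple R * R)) :
    \bar R :=
  \int[beta1_prob (alpha * n%:R)]_w
    prod_prob (fun i => spike_slab sigma (tnth x i) w) (ysection B w).

Variables (alpha sigma : R) (x : n.-tuple R).

Let prior0 : prior alpha sigma x set0 = 0.
Proof.
rewrite /prior; under eq_integral do rewrite ysection0 measure0.
exact: integral0.
Qed.

Let prior_ge0 B : 0 <= prior alpha sigma x B.
Proof. exact: integral_ge0. Qed.

Let prior_sigma_additive : semi_sigma_additive (prior alpha sigma x).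
Proof.
move=> F mF tF mUF.
have -> : prior alpha sigma x (\bigcup_n F n) =
    \sum_(0 <= k <oo) prior alpha sigma x (F k).
  rewrite -integral_nneseries//; last first.
    by move=> k; apply: measurable_prob_ysection => // U mU;
      apply: measurable_prod_prob => // i V mV; exact: measurable_spike_slab.
  apply: eq_integral => w _; rewrite ysection_bigcup.
  apply/esym/cvg_lim => //; apply: measure_sigma_additive.
  - by move=> k; exact: measurable_ysection.
  - exact: trivIset_ysection.
by apply: is_cvg_nneseries => k _ _; exact: prior_ge0.
Qed.

HB.instance Definition _ := isMeasure.Build _ _ _ (prior alpha sigma x)
  prior0 prior_ge0 prior_sigma_additive.

Let prior_setT : prior alpha sigma x setT = 1.
Proof.
have ysT w : prod_prob (fun i => spike_slab sigma (tnth x i) w)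
    (ysection setT w) = 1.
  rewrite (_ : ysection _ _ = setT) ?probability_setT//.
  by apply/seteqP; split => // z _; rewrite /ysection/= inE.
rewrite /prior; under eq_integral do rewrite ysT.
rewrite integral_cst// mul1e; exact: probability_setT.
Qed.

HB.instance Definition _ :=
  @Measure_isProbability.Build _ _ R (prior alpha sigma x) prior_setT.

End prior.

Section posterior.
Context {R : realType} (n : nat).

Definition likelihood (theta x : n.-tuple R) : R :=
  \prod_(i < n) normal_pdf (tnth theta i) 1 (tnth x i).

Definition posterior_weight (alpha kappa sigma : R) (x : n.-tuple R)
    (B : set (n.-tuple R * R)) : \bar R :=
  (\int[prior alpha sigma x]_(z in B) (likelihood z.1 x `^ kappa)%:E)%E.

Definition posterior (alpha kappa sigma : R) (x : n.-tuple R)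
    (B : set (n.-tuple R * R)) : R :=
  fine (posterior_weight alpha kappa sigma x B) /
  fine (posterior_weight alpha kappa sigma x setT).

Definition data_law (theta : n.-tuple R) : probability (n.-tuple R) R :=
  prod_prob (fun i => normal_law (tnth theta i) 1).

Definition sparse (theta : n.-tuple R) (s : nat) : bool :=
  #|[pred i | tnth theta i != 0]| == s.

End posterior.

(* (kappa, v) lies in the region R_beta, v standing for sigma^2. *)
Definition in_region {R : realType} (beta kappa v : R) : bool :=
  1 / (v * (1 + beta / v) `^ (1 / beta)) - 1 / (v + beta) <
  kappa * ((1 - kappa) * beta - 1) / (beta - 1).

Definition eps {R : realType} (s n : nat) : R := s%:R * ln (n%:R / s%:R).

(* Main.v *)
(* Write w for omega. Integrating out theta given w turns the posterior of w
   into Beta(alpha n, 1) reweighted by prod_i a(X_i, w), where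
   a(y, w) = w g(y) + (1 - w) c, g(y) = exp(-kappa y^2 / 2) and
   c = (1 + kappa sigma^2)^(-1/2). Dividing numerator and denominator by g(X_i)
   at the null coordinates i makes each null factor w + (1 - w) c / g(X_i), of
   mean w + (1 - w) c / sqrt(1 - kappa). The region inequality implies
   sigma^2 (1 - kappa) >= 1, hence c <= sqrt(1 - kappa), so that this mean is at
   most 1; the other factors are at most 1 pointwise. By independence the mean
   numerator is at most Beta(alpha n, 1){1 - w > delta} <= exp(-alpha K eps).
   For the denominator, the range s/(2n) <= 1 - w <= s/n alone gives the
   deterministic lower bound exp(-eps - O(s)). Since eps / s tends to infinity,
   K > 2 / alpha is enough. *)
From HB Require Import structures.
Require Import Defs.
From mathcomp Require Import all_boot all_order all_algebra.
From mathcomp Require Import all_classical all_reals all_analysis.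
From mathcomp Require Import measurable_realfun ring lra.
Import Order.TTheory GRing.Theory Num.Theory.
Import numFieldNormedType.Exports.
Local Open Scope classical_set_scope.
Local Open Scope ring_scope.

(** * Integrals against a density, and comparison of integrals *)

Section density.
Context d (T : measurableType d) (R : realType).
Import HBNNSimple.
Local Open Scope ereal_scope.

(** Monotone convergence along the simple approximations [h n] of [f] reduces the identity to simple
    functions, where it is the density formula on each level set. *)
Lemma ge0_integral_density (mu nu : {measure set T -> \bar R}) (p : T -> R)
    (f : T -> \bar R) :
  (forall x, 0 <= p x)%R -> measurable_fun setT p ->
  (forall A, measurable A -> nu A = \int[mu]_(x in A) (p x)%:E) ->
  (forall x, 0 <= f x) -> measurable_fun setT f ->
  \int[nu]_x f x = \int[mu]_x (f x * (p x)%:E).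
Proof.
move=> p0 mp nuE f0 mf.
have mpE : measurable_fun setT (EFin \o p) by exact/measurable_EFinP.
pose h := nnsfun_approx measurableT mf.
have hf x : (h n x)%:E @[n --> \oo] --> f x by exact: cvg_nnsfun_approx.
have hnd x : {homo (fun n => (h n x)%:E) : a b / (a <= b)%N >-> a <= b}.
  by move=> a b ab; rewrite lee_fin; exact/lefP/nd_nnsfun_approx.
transitivity (limn (fun n => \int[nu]_x (h n x)%:E)).
  under eq_integral do rewrite -(cvg_lim _ (hf _))//.
  apply: monotone_convergence => //.
  - by move=> n; apply/measurable_EFinP.
  - by move=> n x _; rewrite lee_fin.
transitivity (limn (fun n => \int[mu]_x ((h n x)%:E * (p x)%:E))); last first.
  have fpE x : f x * (p x)%:E = limn (fun n => (h n x)%:E * (p x)%:E).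
    by apply/esym/cvg_lim => //; exact: cvgeZr.
  under [RHS]eq_integral do rewrite fpE.
  apply/esym/monotone_convergence => //.
  - by move=> n; exact/emeasurable_funM/mpE/measurable_EFinP.
  - by move=> n x _; rewrite mule_ge0// lee_fin.
  - by move=> x _ a b ab; rewrite lee_wpmul2r ?lee_fin//; exact: hnd.
congr (limn _); apply/funext => n.
transitivity (\sum_(y \in range (h n)) y%:E * nu (h n @^-1` [set y])).
  by rewrite integral_nnsfun// patch_setT sintegralE.
under eq_integral.
  move=> x _; rewrite fimfunE -fsumEFin// ge0_mule_fsuml; last first.
    by move=> y; exact: nnfun_muleindic_ge0.
  over.
rewrite ge0_integral_fsum//; last 2 first.
- move=> y; apply: emeasurable_funM => //. apply/measurable_EFinP.
  exact: measurable_funM.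
- by move=> y x _; rewrite mule_ge0 ?nnfun_muleindic_ge0 ?lee_fin.
apply: eq_fsbigr => y; rewrite inE => -[t _ <-].
rewrite nuE// integral_mkcond -ge0_integralZl//.
- apply: eq_integral => x _; rewrite patchE indicE EFinM -muleA.
  by case: ifPn => _; rewrite ?mul1e ?mul0e.
- by apply/(measurable_restrict _ _ _) => //; apply: measurable_funTS.
- by move=> x _; apply: erestrict_ge0 => z _; rewrite lee_fin.
- by rewrite lee_fin.
Qed.

(** The integral of a nonnegative function is a supremum over simple functions below it, so
    monotonicity asks for no measurability. This lets the posterior be bounded directly as a
    function of the data. *)
Lemma ge0_le_integral_nomeas (mu : {measure set T -> \bar R}) (f g : T -> \bar R) :
  (forall x, 0 <= f x) -> (forall x, f x <= g x) ->
  \int[mu]_x f x <= \int[mu]_x g x.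
Proof.
move=> f0 fg; have g0 x : 0 <= g x by exact: le_trans (f0 x) (fg x).
rewrite !ge0_integralTE//; apply: le_ereal_sup => _ [h hf <-].
by exists h => // x; exact: le_trans (hf x) (fg x).
Qed.

End density.

(** * Integrals of products under independence *)

Section prod_prob_integral.
Context d (T : measurableType d) (R : realType).
Local Open Scope ereal_scope.

Lemma measurable_prod_tnth n (f : 'I_n -> T -> R) :
  (forall i, measurable_fun setT (f i)) ->
  measurable_fun setT (fun t : n.-tuple T => (\prod_(i < n) f i (tnth t i))%R).
Proof.
move=> mf; apply: measurable_prod => i _.
by apply: (measurableT_comp (mf i)); exact: measurable_tnth.
Qed.

(** Induction on [n]: the law is a pushforward along [tuple_cons], and Tonelli splits off the first
    coordinate. *)
Lemma integral_prod_prob n (P : 'I_n -> probability T R) (f : 'I_n -> T -> R) :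
  (forall i x, 0 <= f i x)%R -> (forall i, measurable_fun setT (f i)) ->
  \int[prod_prob P]_t (\prod_(i < n) f i (tnth t i))%:E =
  \prod_(i < n) \int[P i]_x (f i x)%:E.
Proof.
elim: n => [|n IH] in P f *; move=> f0 mf.
  rewrite big_ord0 /= integral_dirac// ?diracT ?mul1e ?big_ord0//.
  by apply/measurable_EFinP; exact: measurable_prod_tnth.
have m_f : measurable_fun setT
    (fun t : n.+1.-tuple T => (\prod_(i < n.+1) f i (tnth t i))%:E).
  by apply/measurable_EFinP; exact: measurable_prod_tnth.
have f_ge0 (t : n.+1.-tuple T) : 0 <= (\prod_(i < n.+1) f i (tnth t i))%:E.
  by rewrite lee_fin prodr_ge0.
rewrite /= ge0_integral_pushforward//=.
have m_tc : measurable_fun setT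
   (fun z : T * n.-tuple T => (\prod_(i < n.+1) f i (tnth (tuple_cons z) i))%:E).
  by apply: (measurableT_comp m_f); exact: measurable_tuple_cons.
rewrite preimage_setT.
rewrite fubini_tonelli1//= /fubini_F/=.
rewrite big_ord_recl -IH//.
rewrite -ge0_integralZr//; last 3 first.
- exact/measurable_EFinP.
- by move=> x _; rewrite lee_fin.
- by apply: integral_ge0 => t _; rewrite lee_fin prodr_ge0.
apply: eq_integral => x _.
rewrite -ge0_integralZl//; last 3 first.
- by apply/measurable_EFinP;
    exact: (@measurable_prod_tnth _ (fun i => f (lift ord0 i))).
- by move=> t _; rewrite lee_fin prodr_ge0.
- by rewrite lee_fin.
apply: eq_integral => t _; rewrite -EFinM big_ord_recl tnth0.
by under eq_bigr do rewrite tnthS.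
Qed.

End prod_prob_integral.

(** * Iterated integrals from a disintegrated law *)

Section disintegration.
Context d d' (T : measurableType d) (Y : measurableType d') (R : realType).
Local Open Scope ereal_scope.

Definition pair_at (w : T) (t : Y) : Y * T := (t, w).

Lemma measurable_pair_at w : measurable_fun setT (pair_at w).
Proof. exact: measurable_fun_pair. Qed.

HB.instance Definition _ w :=
  isMeasurableFun.Build _ _ _ _ (pair_at w) (measurable_pair_at w).

(** The measure [nu] is a composition of kernels: draw [w] from [mu], then push [k w] forward to the
    slice at [w]. The integral formula for composed kernels then applies. *)
Lemma ge0_integral_disintegration (mu : probability T R) (k : T -> probability Y R)
    (nu : {measure set (Y * T) -> \bar R}) (f : Y * T -> \bar R) :
  (forall U, measurable U -> measurable_fun setT (fun w => k w U)) ->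
  (forall B, measurable B -> nu B = \int[mu]_w k w (ysection B w)) ->
  (forall z, 0 <= f z) -> measurable_fun setT f ->
  \int[nu]_z f z = \int[mu]_w \int[k w]_t f (t, w).
Proof.
move=> mk nuE f0 mf.
(* Kernel composition expects a common source for both kernels; [unit] serves as a one-point source,
   hence the projection [p.2]. *)
pose k' (p : (unit * T)%type) : probability (Y * T)%type R := distribution (k p.2) (pair_at p.2).
have k'E p B : k' p B = k p.2 (ysection B p.2).
  by congr (k _ _); apply/seteqP; split => t; rewrite /ysection/= ?inE.
have mk' B : measurable B -> measurable_fun setT (fun p => k' p B).
  move=> mB; under eq_fun do rewrite k'E.
  apply: (measurableT_comp (f := fun w => k w (ysection B w))) => //.
  exact: measurable_prob_ysection.
have mmu B : measurable B -> measurable_fun setT (fun _ : unit => mu B).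
  by move=> _; exact: measurable_cst.
transitivity (\int[kcomp (prob_family mmu) (prob_family mk') tt]_z f z).
  apply: eq_measure_integral => B mB _; rewrite nuE//= /kcomp.
  by apply: eq_integral => w _; exact/esym/k'E.
rewrite integral_kcomp//; apply: eq_integral => w _.
by rewrite [LHS]ge0_integral_pushforward.
Qed.

End disintegration.

(** * Spike-and-slab and Gaussian integrals *)

Section spike_slab_integral.
Context {R : realType}.
Local Open Scope ereal_scope.

Lemma ge0_integral_spike_slab (sigma x w : R) (f : R -> \bar R) :
  (forall t, 0 <= f t) -> measurable_fun setT f ->
  \int[spike_slab sigma x w]_t f t =
  if (0 <= w <= 1)%R then
    w%:E * f 0%R + (1 - w)%:E * \int[normal_law x sigma]_t f t
  else f 0%R.
Proof.
move=> f0 mf; case: ifPn => [w01|w01]; last first.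
  rewrite (eq_measure_integral (\d_(0%R : R))) => [|A mA _].
    by rewrite integral_dirac// diracT mul1e.
  by rewrite /= /spike_slab (negbTE w01).
have /andP[w0 w1] := w01; have w1' : (0 <= 1 - w)%R by rewrite subr_ge0.
rewrite (eq_measure_integral (measure_add (mscale (NngNum w0) (\d_(0%R : R)))
    (mscale (NngNum w1') (normal_law x sigma)))) => [|A mA _]; last first.
  by rewrite /= /spike_slab w01; exact/esym/measure_addE.
rewrite ge0_integral_measure_add// !ge0_integral_mscale//=.
by rewrite integral_dirac// diracT mul1e.
Qed.

(* normal_law lives on the default measurable structure of R and lebesgue_measure
   on measurableTypeR: the identity transports one onto the other. *)
Lemma ge0_integral_normal_law (m s : R) (f : R -> \bar R) :
  (forall t, 0 <= f t) -> measurable_fun setT f ->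
  \int[normal_law m s]_t f t =
  \int[lebesgue_measure]_t (f t * (normal_pdf m s t)%:E).
Proof.
move=> f0 mf.
have mid : measurable_fun setT (id : measurableTypeR R -> R) by [].
transitivity (\int[pushforward (normal_prob m s) (id : measurableTypeR R -> R)]_t f t).
  by apply: eq_measure_integral.
rewrite ge0_integral_pushforward//= preimage_setT.
apply: ge0_integral_density => //; first exact: normal_pdf_ge0.
exact: measurable_normal_pdf.
Qed.

Lemma normal_peakE (s : R) : (0 < s)%R ->
  normal_peak s = ((Num.sqrt (pi *+ 2))^-1 / s)%R.
Proof.
move=> s0; rewrite /normal_peak -mulrnAr sqrtrM ?sqr_ge0// sqrtr_sqr gtr0_norm//.
by rewrite invfM mulrC.
Qed.

(** Completing the Gaussian: the integrand times the density is a multiple of the normal density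
    with standard deviation [r^-1], where [r ^+ 2 = a + s ^- 2]. The parameter [a] may be negative:
    it is [kappa] for the slab and [- kappa] for the moment of a null coordinate. *)
Lemma integral_normal_law_expR (m s a : R) : (0 < s)%R -> (0 < a + s ^- 2)%R ->
  \int[normal_law m s]_t (expR (- (a * (t - m) ^+ 2 / 2)))%:E =
  ((s * Num.sqrt (a + s ^- 2))^-1)%:E.
Proof.
move=> s0 h.
set r := Num.sqrt (a + s ^- 2); have r0 : (0 < r)%R by rewrite sqrtr_gt0.
have r2 : (r ^+ 2 = a + s ^- 2)%R by rewrite sqr_sqrtr// ltW.
have ri0 : (0 < r^-1)%R by rewrite invr_gt0.
rewrite ge0_integral_normal_law//; last first.
  apply/measurable_EFinP; apply: measurableT_comp => //.
  apply: measurableT_comp => //; apply: measurable_funM => //.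
  apply: measurable_funM => //; apply: measurable_funX => //.
  exact: measurable_funB.
transitivity (\int[lebesgue_measure]_t ((s * r)^-1%:E * (normal_pdf m r^-1 t)%:E)).
  apply: eq_integral => t _; rewrite -!EFinM; congr EFin.
  rewrite !normal_pdfE ?gt_eqF// !normal_peakE// /normal_fun.
  rewrite mulrCA -expRD [RHS]mulrA; congr (_ * expR _)%R.
    by field; rewrite !gt_eqF// sqrtr_gt0 mulrn_wgt0// pi_gt0.
  have -> : ((r^-1) ^+ 2 *+ 2 = (r ^+ 2 / 2) ^-1)%R by field; rewrite gt_eqF.
  by rewrite invrK r2; field; rewrite gt_eqF.
rewrite ge0_integralZl//; last 3 first.
- by apply/measurable_EFinP; exact: measurable_normal_pdf.
- by move=> t _; rewrite lee_fin normal_pdf_ge0.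
- by rewrite lee_fin invr_ge0 mulr_ge0// ltW.
by rewrite integral_normal_pdf mule1.
Qed.

End spike_slab_integral.

(** * Interval probabilities of the Beta(a, 1) law *)

Section beta1_intervals.
Context {R : realType} (a : R) (a0 : 0 < a).

Lemma beta1_prob_itv1 (y : R) : 0 < y < 1 ->
  beta1_prob a `[y, 1] = (1 - y `^ a)%:E.
Proof.
move=> /andP[y0 y1]; rewrite /beta1_prob.
transitivity (\int[lebesgue_measure]_(x in `[y, 1%R]) (a * x `^ (a - 1))%:E)%E.
  rewrite -integral_itv_bndo_bndc; last first.
    by apply/measurable_EFinP/measurable_funTS; exact: measurable_beta1_pdf.
  rewrite -[RHS]integral_itv_bndo_bndc; last first.
    apply/measurable_EFinP/measurable_funTS.
    by apply: measurable_funM => //; exact: measurable_powR.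
  apply: eq_integral => x; rewrite inE/= in_itv/= => /andP[yx x1].
  by rewrite /beta1_pdf a0 indicE mem_set ?mulr1//= in_itv/= x1 (lt_le_trans y0).
have powRc b : {within `[y, 1], continuous (fun x : R => x `^ b)}.
  apply: derivable_within_continuous => x; rewrite in_itv/= => /andP[yx _].
  by apply: ex_derive; apply: is_derive1_powR; exact: lt_le_trans yx.
rewrite (@continuous_FTC2 _ _ (fun x => x `^ a))//.
- by rewrite powR1 EFinB.
- apply: derivable_within_continuous => x; rewrite in_itv/= => /andP[yx _].
  apply: derivableM => //; apply: ex_derive; apply: is_derive1_powR.
  exact: lt_le_trans yx.
- have /continuous_within_itvP-/(_ y1)[_ h0 h1] := powRc a.
  split => // x; rewrite in_itv/= => /andP[yx _].
  by apply: ex_derive; apply: is_derive1_powR; exact: lt_trans yx.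
- move=> x; rewrite in_itv/= => /andP[yx _].
  by rewrite powR_derive1// in_itv/= andbT (lt_trans _ yx).
Qed.

(** Subadditivity over [[y, z]] and [[z, 1]] gives the lower bound that the posterior denominator
    calls for. *)
Lemma beta1_prob_itv_ge (y z : R) : 0 < y -> y < z -> z < 1 ->
  ((z `^ a - y `^ a)%:E <= beta1_prob a `[y, z])%E.
Proof.
move=> y0 yz z1.
have : (beta1_prob a `[y, 1%R] <= beta1_prob a `[y, z] + beta1_prob a `[z, 1%R])%E.
  rewrite (le_trans _ (measureU2 _ _ _))//; apply: le_measure; rewrite ?inE//.
    exact: measurableU.
  move=> x /=; rewrite !in_itv/= => /andP[-> ->]; rewrite andbT.
  by case: (leP x z) => [|/ltW]; [left|right].
rewrite !beta1_prob_itv1 ?y0 ?(lt_trans yz)// ?(lt_trans y0)//.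
rewrite -leeBlDr// -EFinB; apply: le_trans.
by rewrite lee_fin; lra.
Qed.

(** For [u < 1] the tail is at most (1 - u)^a, and ln(1 - u) <= -u. For [u >= 1] the event misses
    the support. *)
Lemma beta1_prob_upper_tail (u : R) : 0 < u ->
  (beta1_prob a [set w | (1 - w > u)%R] <= (expR (- (a * u)))%:E)%E.
Proof.
move=> u0.
have [u1|u1] := leP 1 u.
  rewrite [leLHS]integral0_eq ?lee_fin ?expR_ge0// => x/= xu.
  rewrite /beta1_pdf indicE memNset ?mulr0//= in_itv/= => /andP[x0 x1].
  by move: xu; apply/negP; rewrite -leNgt; lra.
have -> : [set w : R | 1 - w > u] = ~` `[1 - u, +oo[.
  apply/seteqP; split => w/=; rewrite in_itv/= andbT.
    by move=> h; apply/negP; rewrite -ltNge; lra.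
  by move/negP; rewrite -ltNge; lra.
rewrite (@probability_setC _ _ _ (beta1_prob a))//.
apply: (@le_trans _ _ (1 - beta1_prob a `[(1 - u)%R, 1%R])%E).
  apply: leeB => //; apply: le_measure; rewrite ?inE//.
  by move=> x /=; rewrite !in_itv/= => /andP[->].
rewrite beta1_prob_itv1; last by lra.
rewrite -EFinB lee_fin opprB addrC subrK.
rewrite /powR gt_eqF ?subr_gt0// ler_expR -mulrN ler_pM2l//.
by have := @le_ln1Dx R (- u); apply; rewrite ltrNl opprK.
Qed.

End beta1_intervals.

(** * Consequence of the region inequality *)

Section region.
Context {R : realType}.

(* Young's inequality gives (1 + beta / v)^(1 / beta) <= 1 + 1 / v. If
   a := 1 - kappa had v * a < 1, the region inequality would then force
   (1 - a^2 * beta)^2 < 0. *)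
Lemma in_region_ge1 (beta kappa v : R) :
  1 < beta -> 0 < kappa < 1 -> 0 < v -> in_region beta kappa v ->
  1 <= v * (1 - kappa).
Proof.
move=> b1 /andP[k0 k1] v0; rewrite /in_region => reg.
have b0 : 0 < beta by lra.
rewrite leNgt; apply/negP => va.
set a := 1 - kappa in reg va; have a0 : 0 < a by rewrite subr_gt0.
have ka : kappa = 1 - a by rewrite /a; ring.
have bern : (1 + beta / v) `^ (1 / beta) <= (v + 1) / v.
  have x0 : 0 <= 1 + beta / v by rewrite addr_ge0// divr_ge0// ltW.
  have := @conjugate_powR R ((1 + beta / v) `^ (1 / beta)) 1 beta
    (beta / (beta - 1)) (powR_ge0 _ _) ler01 b0.
  rewrite powR1 mulr1 -powRrM divfK ?gt_eqF// powRr1//.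
  have bb : 0 < beta / (beta - 1) by rewrite divr_gt0// subr_gt0.
  move=> /(_ bb); rewrite invf_div.
  have -> : beta^-1 + (beta - 1) / beta = 1 by field; rewrite gt_eqF.
  move=> /(_ erefl)/le_trans; apply.
  by rewrite le_eqVlt; apply/orP; left; apply/eqP; field; rewrite !gt_eqF.
have p0 : 0 < (1 + beta / v) `^ (1 / beta).
  by rewrite powR_gt0// ltr_wpDl// divr_gt0.
rewrite [1 / beta]div1r in reg bern p0.
have lhs : 1 / (v + 1) - 1 / (v + beta) <
    kappa * (a * beta - 1) / (beta - 1).
  apply: le_lt_trans reg; rewrite lerB// !div1r lef_pV2 ?posrE ?mulr_gt0//.
    by rewrite mulrC -ler_pdivlMr.
  by rewrite addr_gt0.
have {}lhs : (beta - 1) ^+ 2 < kappa * (a * beta - 1) * ((v + 1) * (v + beta)).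
  have e : 1 / (v + 1) - 1 / (v + beta) = (beta - 1) / ((v + 1) * (v + beta)).
    by field; rewrite !gt_eqF ?addr_gt0.
  move: lhs; rewrite e ltr_pdivrMr ?mulr_gt0 ?addr_gt0//.
  rewrite [ltRHS]mulrAC ltr_pdivlMr ?subr_gt0//.
have D0 : 0 < (v + 1) * (v + beta) by rewrite mulr_gt0 ?addr_gt0.
(* A square lies strictly below the right side of [lhs], so that side is positive, and so is its
   factor [a * beta - 1]; multiplying by it later keeps the order. *)
have ab1 : 0 < a * beta - 1.
  have : 0 < kappa * (a * beta - 1) * ((v + 1) * (v + beta)).
    by apply: le_lt_trans lhs; exact: sqr_ge0.
  by rewrite (pmulr_lgt0 _ D0) (pmulr_rgt0 _ k0).
(* This is where the assumption [v * a < 1] enters, after distributing one factor [a] to each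
   bracket. *)
have : a ^+ 2 * ((v + 1) * (v + beta)) <= (1 + a) * (1 + a * beta).
  have -> : a ^+ 2 * ((v + 1) * (v + beta)) = (v * a + a) * (v * a + a * beta).
    ring.
  have va0 : 0 < v * a by exact: mulr_gt0.
  have ab0 : 0 < a * beta by exact: mulr_gt0.
  by apply: ler_pM; lra.
have k'0 : 0 < kappa * (a * beta - 1) by exact: mulr_gt0.
rewrite -(ler_pM2l k'0) => up.
have : a ^+ 2 * (beta - 1) ^+ 2 <
   kappa * (a * beta - 1) * (a ^+ 2 * ((v + 1) * (v + beta))).
  by rewrite [ltRHS]mulrCA ltr_pM2l// exprn_gt0.
move=> /lt_le_trans/(_ up); rewrite ka.
have := sqr_ge0 (1 - a ^+ 2 * beta).
have -> : (1 - a ^+ 2 * beta) ^+ 2 = a ^+ 2 * (beta - 1) ^+ 2 -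
  (1 - a) * (a * beta - 1) * ((1 + a) * (1 + a * beta)) by ring.
by rewrite subr_ge0 => /le_lt_trans h /h; rewrite ltxx.
Qed.

End region.

(** * Explicit estimates for the ratio of tail to denominator *)

Section asymptotics.
Context {R : realType}.

(** Since exp(2x) >= 1 + 2x, it suffices that (1 - x)(1 + 2x) >= 1, which holds exactly for x
    between 0 and 1/2. *)
Lemma expRN2_le (x : R) : 0 <= x <= 1 / 2 -> expR (- (2 * x)) <= 1 - x.
Proof.
move=> /andP[x0 x1]; rewrite expRN invf_ple ?posrE ?expR_gt0//; last by lra.
apply: le_trans (expR_ge1Dx _); rewrite -div1r ler_pdivrMr; last by lra.
by nra.
Qed.

(** With L = ln(n/s), the denominator is at least exp(-2s + s(ln(c/2) - L) - alpha s)/2, while the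
    numerator is exp(-alpha K s L). As alpha K > 2, a surplus of at least sL remains, and the lower
    bound on L makes it absorb the terms of order s. The constant 3 is 2 from [y ^+ n] plus 1 for
    the final exp(-s). *)
Lemma tail_ratio_le (alpha c K : R) (n s : nat) : 0 < alpha -> 0 < c ->
  2 < alpha * K -> (0 < n)%N -> (0 < s)%N -> s%:R / n%:R <= 1 / 2 :> R ->
  2 <= alpha * s%:R ->
  3 + alpha - ln (c / 2) <= ln (n%:R / s%:R) ->
  let y : R := 1 - s%:R / n%:R in let z : R := 1 - s%:R / (2 * n%:R) in
  expR (- (alpha * n%:R * (K * eps s n / n%:R))) /
    (y ^+ n * ((1 - z) * c) ^+ s *
      (z `^ (alpha * n%:R) - y `^ (alpha * n%:R))) <= 2 * expR (- s%:R).
Proof.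
move=> alpha0 c0 aK; rewrite /eps -!(@ltr0n R) => n0 s0.
set L := ln (n%:R / s%:R); set x := s%:R / n%:R.
move=> x1 as2 Lge; set y := 1 - x; set z := 1 - s%:R / (2 * n%:R).
have x0 : 0 < x by rewrite divr_gt0.
have zE : z = 1 - x / 2 by rewrite /z /x; field; rewrite gt_eqF.
have nx : n%:R * x = s%:R by rewrite /x; field; rewrite gt_eqF.
have yge : expR (- (2 * s%:R)) <= y ^+ n.
  have -> : - (2 * s%:R) = n%:R * (- (2 * x)) by rewrite -nx; ring.
  by rewrite expRM_natl lerXn2r ?nnegrE ?expR_ge0//; [rewrite /y; lra|
     apply: expRN2_le; rewrite x1 ltW].
(* Here 1 - z = s/(2n) = exp(-L)/2. *)
have sE : ((1 - z) * c) ^+ s = expR (s%:R * (ln (c / 2) - L)).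
  rewrite expRM_natl; congr (_ ^+ s).
  rewrite expRD expRN !lnK ?posrE ?divr_gt0// zE /x.
  by field; rewrite !gt_eqF.
have an0 : 0 < alpha * n%:R by exact: mulr_gt0.
have z0 : 0 < z by rewrite zE; lra.
have y0 : 0 < y by rewrite /y; lra.
have zge : expR (- (alpha * s%:R)) <= z `^ (alpha * n%:R).
  have -> : - (alpha * s%:R) = - x * (alpha * n%:R) by rewrite -nx; ring.
  rewrite expRM ge0_ler_powR ?nnegrE ?expR_ge0// ?(ltW z0) ?(ltW an0)//.
  have := @expRN2_le (x / 2); rewrite mulrCA divff ?mulr1// -zE; apply; lra.
(* From y <= z exp(-x/2), the power alpha n gains the factor exp(-alpha s/2), which is at most 1/2
   because alpha s >= 2. So at least half of [z]'s power survives the subtraction. *)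
have yle : y `^ (alpha * n%:R) <= z `^ (alpha * n%:R) / 2.
  have yz : y <= z * expR (- (x / 2)).
    apply: (@le_trans _ _ (z * (1 + - (x / 2)))).
      by rewrite /y zE; nra.
    by rewrite ler_pM2l// expR_ge1Dx.
  have := @ge0_ler_powR R (alpha * n%:R) (ltW an0) y (z * expR (- (x / 2))).
  rewrite !nnegrE (ltW y0) mulr_ge0 ?expR_ge0 ?(ltW z0)// => /(_ erefl erefl yz).
  move=> /le_trans; apply; rewrite powRM ?expR_ge0 ?(ltW z0)// -expRM.
  rewrite ler_pM2l ?powR_gt0//.
  have -> : - (x / 2) * (alpha * n%:R) = - (alpha * s%:R / 2) by rewrite -nx; ring.
  rewrite expRN lef_pV2 ?posrE ?expR_gt0//.
  by apply: le_trans (expR_ge1Dx _); lra.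
have dge : expR (- (2 * s%:R)) * expR (s%:R * (ln (c / 2) - L)) *
    (expR (- (alpha * s%:R)) / 2) <=
    y ^+ n * ((1 - z) * c) ^+ s * (z `^ (alpha * n%:R) - y `^ (alpha * n%:R)).
  apply: ler_pM; rewrite ?mulr_ge0 ?expR_ge0//; last by lra.
  by rewrite sE ler_pM2r ?expR_gt0.
rewrite ler_pdivrMr; last by apply: lt_le_trans dge; rewrite !mulr_gt0 ?expR_gt0.
have -> : alpha * n%:R * (K * (s%:R * L) / n%:R) = alpha * K * (s%:R * L).
  by field; rewrite gt_eqF.
apply: (@le_trans _ _ (2 * expR (- s%:R) * (expR (- (2 * s%:R)) *
    expR (s%:R * (ln (c / 2) - L)) * (expR (- (alpha * s%:R)) / 2)))); last first.
  by rewrite ler_pM2l// mulr_gt0// expR_gt0.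
have -> : 2 * expR (- s%:R) * (expR (- (2 * s%:R)) *
    expR (s%:R * (ln (c / 2) - L)) * (expR (- (alpha * s%:R)) / 2)) =
  expR (- s%:R + (- (2 * s%:R) + s%:R * (ln (c / 2) - L) + - (alpha * s%:R))).
  by rewrite !expRD; field.
rewrite ler_expR.
have L0 : 0 <= L.
  by rewrite ln_ge0// -invf_div -/x -[leLHS]invr1 lef_pV2 ?posrE//; lra.
have sL0 : 0 <= s%:R * L by rewrite mulr_ge0 ?(ltW s0).
have : 2 * (s%:R * L) <= alpha * K * (s%:R * L) by rewrite ler_wpM2r// ltW.
have : s%:R * (3 + alpha - ln (c / 2)) <= s%:R * L by rewrite ler_pM2l.
by nra.
Qed.

End asymptotics.

(** * Integrating the means out of the posterior *)

Section posterior_bound.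
Context {R : realType}.

(** Equal to (1 + kappa sigma^2)^(-1/2) for positive [sigma], kept in the form produced by
    [integral_normal_law_expR]. *)
Definition slab_weight (kappa sigma : R) : R :=
  (sigma * Num.sqrt (kappa + sigma ^- 2))^-1.

(* The integral of (p_t(y) / p_y(y))^kappa against the spike-and-slab law of t;
   the value for w outside [0, 1] follows the dummy value of spike_slab. *)
Definition marginal_factor (kappa sigma y w : R) : R :=
  let g := expR (- (kappa * y ^+ 2 / 2)) in
  if 0 <= w <= 1 then w * g + (1 - w) * slab_weight kappa sigma else g.

Section marginal_factor_theory.
Variables (kappa sigma : R) (kappa0 : 0 < kappa) (sigma0 : 0 < sigma).
Local Notation c := (slab_weight kappa sigma).
Local Notation g y := (expR (- (kappa * y ^+ 2 / 2))).

Lemma slab_weight_gt0 : 0 < c.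
Proof. by rewrite invr_gt0 mulr_gt0// sqrtr_gt0 addr_gt0// invr_gt0 exprn_gt0. Qed.

Lemma slab_weight_le1 : c <= 1.
Proof.
rewrite invf_le1; last by rewrite -invr_gt0 slab_weight_gt0.
rewrite -[leLHS](@divff _ sigma) ?gt_eqF// ler_pM2l//.
have <- : Num.sqrt (sigma ^- 2) = sigma^-1.
  by rewrite -exprVn sqrtr_sqr ger0_norm// invr_ge0 ltW.
by rewrite ler_wsqrtr// lerDr ltW.
Qed.

Lemma spike_le1 y : g y <= 1.
Proof. by rewrite -expR0 ler_expR oppr_le0 divr_ge0// mulr_ge0 ?sqr_ge0// ltW. Qed.

Lemma marginal_factor_ge0 y w : 0 <= marginal_factor kappa sigma y w.
Proof.
rewrite /marginal_factor; case: ifPn => [/andP[w0 w1]|_]; last exact: expR_ge0.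
by rewrite addr_ge0// mulr_ge0 ?expR_ge0 ?subr_ge0// ltW// slab_weight_gt0.
Qed.

Lemma marginal_factor_le1 y w : marginal_factor kappa sigma y w <= 1.
Proof.
rewrite /marginal_factor; case: ifPn => [/andP[w0 w1]|_]; last exact: spike_le1.
rewrite [leRHS](_ : 1 = w * 1 + (1 - w) * 1); last by ring.
by rewrite lerD// ler_wpM2l ?subr_ge0 ?spike_le1 ?slab_weight_le1.
Qed.

Lemma measurable_spike : measurable_fun setT (fun y : R => g y).
Proof.
apply: measurableT_comp => //; apply: measurableT_comp => //.
by do 2 apply: measurable_funM => //; exact: measurable_funX.
Qed.

Lemma measurable_shifted_spike y : measurable_fun setT (fun t : R => g (t - y)).
Proof.
have mB : measurable_fun setT (fun t : R => t - y) by exact: measurable_funB.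
exact: (measurableT_comp measurable_spike mB).
Qed.

Lemma measurable_marginal_factor :
  measurable_fun setT (fun p : R * R => marginal_factor kappa sigma p.1 p.2).
Proof.
have mg : measurable_fun setT (fun p : R * R => g p.1).
  by apply: (measurableT_comp measurable_spike).
apply: measurable_fun_ifT => //=.
  by apply: measurable_and; apply: measurable_fun_ler.
apply: measurable_funD; apply: measurable_funM => //.
exact: measurable_funB.
Qed.

Lemma normal_pdf_powR t y :
  normal_pdf t 1 y `^ kappa =
  normal_peak 1 `^ kappa * expR (- (kappa * (t - y) ^+ 2 / 2)).
Proof.
rewrite normal_pdfE ?oner_eq0// powRM ?normal_peak_ge0 ?expR_ge0//.
by rewrite /normal_fun -expRM; congr (_ * expR _); field.
Qed.

(** The slab is centred at the observation [y] itself, so its contribution is a constant free of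
    [y]; only the spike term depends on the data. *)
Lemma integral_spike_slab_pdf y w :
  (\int[spike_slab sigma y w]_t (normal_pdf t 1 y `^ kappa)%:E =
   (normal_peak 1 `^ kappa * marginal_factor kappa sigma y w)%:E)%E.
Proof.
have mf : measurable_fun setT
    (fun t : R => (expR (- (kappa * (t - y) ^+ 2 / 2)))%:E).
  by apply/measurable_EFinP; exact: measurable_shifted_spike.
under eq_integral do rewrite normal_pdf_powR EFinM.
rewrite ge0_integralZl//; last by rewrite lee_fin powR_ge0.
rewrite EFinM; congr (_ * _)%E.
rewrite ge0_integral_spike_slab//.
rewrite /marginal_factor sub0r sqrrN; case: ifPn => // _.
by rewrite integral_normal_law_expR ?addr_gt0 ?invr_gt0 ?exprn_gt0.
Qed.

Lemma powR_prod (I : Type) (r : seq I) (F : I -> R) (k : R) :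
  (forall i, 0 <= F i) ->
  (\prod_(i <- r) F i) `^ k = \prod_(i <- r) F i `^ k.
Proof.
move=> F0; elim: r => [|i r IH]; first by rewrite !big_nil powR1.
by rewrite !big_cons powRM ?prodr_ge0// IH.
Qed.

Lemma likelihood_powR n (t x : n.-tuple R) : likelihood t x `^ kappa =
  \prod_(i < n) (normal_pdf (tnth t i) 1 (tnth x i) `^ kappa).
Proof. by rewrite /likelihood powR_prod// => i; exact: normal_pdf_ge0. Qed.

Lemma measurable_normal_pdf_powR y :
  measurable_fun setT (fun t : R => normal_pdf t 1 y `^ kappa).
Proof.
under eq_fun do rewrite normal_pdf_powR.
by apply: measurable_funM => //; exact: measurable_shifted_spike.
Qed.

(** Given [w] the coordinates are independent under the prior and the likelihood is a product, so
    the inner integral factorizes. *)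
Lemma posterior_weightE (alpha : R) n (x : n.-tuple R) (A : set R) :
  measurable A ->
  (posterior_weight alpha kappa sigma x (snd @^-1` A) =
   (normal_peak 1 `^ kappa ^+ n)%:E *
   \int[beta1_prob (alpha * n%:R)]_(w in A)
     (\prod_(i < n) marginal_factor kappa sigma (tnth x i) w)%:E)%E.
Proof.
move=> mA.
have inner w : (\int[prod_prob (fun i => spike_slab sigma (tnth x i) w)]_t
    (likelihood t x `^ kappa)%:E =
    (normal_peak 1 `^ kappa ^+ n)%:E *
    (\prod_(i < n) marginal_factor kappa sigma (tnth x i) w)%:E)%E.
  under eq_integral do rewrite likelihood_powR.
  rewrite (@integral_prod_prob _ _ R n _ (fun i t => normal_pdf t 1 (tnth x i) `^ kappa)).
  - under eq_bigr do rewrite integral_spike_slab_pdf.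
    by rewrite prodEFin big_split/= prodr_const card_ord.
  - by move=> i t; exact: powR_ge0.
  - by move=> i; exact: measurable_normal_pdf_powR.
have mB : measurable (snd @^-1` A : set (n.-tuple R * R)).
  by rewrite -[X in measurable X]setTI; exact: measurable_snd.
have mlik : measurable_fun setT (fun z : n.-tuple R * R =>
    (likelihood z.1 x `^ kappa)%:E).
  apply/measurable_EFinP; under eq_fun do rewrite likelihood_powR.
  apply: (measurableT_comp (f := fun t : n.-tuple R =>
    \prod_(i < n) (normal_pdf (tnth t i) 1 (tnth x i) `^ kappa))) => //.
  apply: (@measurable_prod_tnth _ _ _ n (fun i t => normal_pdf t 1 (tnth x i) `^ kappa)).
  by move=> i; exact: measurable_normal_pdf_powR.
rewrite /posterior_weight integral_mkcond.
rewrite (@ge0_integral_disintegration _ _ _ _ _ (beta1_prob (alpha * n%:R))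
  (fun w => prod_prob (fun i => spike_slab sigma (tnth x i) w)))//; last 3 first.
- move=> U mU; apply: measurable_prod_prob => // i V mV.
  exact: measurable_spike_slab.
- by move=> z; apply: erestrict_ge0 => {}z _; rewrite lee_fin powR_ge0.
- by apply/(measurable_restrictT _ mB); exact: measurable_funTS.
rewrite -ge0_integralZl//; last 3 first.
- apply/measurable_EFinP/measurable_funTS; apply: measurable_prod => i _.
  apply: (measurableT_comp measurable_marginal_factor (g := fun w : R => (tnth x i, w))).
  exact: measurable_fun_pair.
- by move=> w _; rewrite lee_fin prodr_ge0// => i _; exact: marginal_factor_ge0.
- by rewrite lee_fin exprn_ge0// powR_ge0.
rewrite [RHS]integral_mkcond; apply: eq_integral => w _.
rewrite patchE; case: ifPn => wA.
  rewrite -inner; apply: eq_integral => t _.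
  by rewrite patchE ifT// inE; rewrite inE in wA.
apply: integral0_eq => t _.
by rewrite patchE ifF//; apply: contraNF wA; rewrite !inE.
Qed.

End marginal_factor_theory.
End posterior_bound.

(** * Factors normalized by the spike at null coordinates *)

Section scaled_factor.
Context {R : realType}.
Variables (kappa sigma : R) (kappa0 : 0 < kappa) (sigma0 : 0 < sigma).
Local Notation c := (slab_weight kappa sigma).
Local Notation g y := (expR (- (kappa * y ^+ 2 / 2))).

Definition scaled_factor (null : bool) (y w : R) : R :=
  marginal_factor kappa sigma y w / (if null then g y else 1).

Lemma scaled_factor_ge0 b y w : 0 <= scaled_factor b y w.
Proof.
by rewrite divr_ge0 ?marginal_factor_ge0//; case: b; rewrite ?expR_ge0.
Qed.

Lemma measurable_scaled_factor b :
  measurable_fun setT (fun p : R * R => scaled_factor b p.1 p.2).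
Proof.
apply: measurable_funM; first exact: measurable_marginal_factor.
case: b => /=; last exact: measurable_cst.
under eq_fun do rewrite -expRN opprK.
apply: measurableT_comp => //.
by do 2 apply: measurable_funM => //; exact: measurable_funX.
Qed.

(** Only one of the two nonnegative terms is kept: the spike, which becomes [w] after scaling, at a
    null coordinate, and the slab otherwise. The bound is therefore free of the observation. *)
Lemma scaled_factor_itv_ge b (y z : R) t w : 0 <= y -> z <= 1 -> y <= w <= z ->
  (if b then y else (1 - z) * c) <= scaled_factor b t w.
Proof.
move=> y0 z1 /andP[yw wz]; rewrite /scaled_factor /marginal_factor.
have w01 : 0 <= w <= 1 by rewrite (le_trans y0) ?(le_trans wz).
have c0 := slab_weight_gt0 kappa sigma kappa0 sigma0.
have g0 := expR_gt0 (- (kappa * t ^+ 2 / 2)).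
rewrite w01; case: b; rewrite ?divr1.
  rewrite ler_pdivlMr//.
  have : y * g t <= w * g t by rewrite ler_wpM2r// ltW.
  have : 0 <= (1 - w) * c by rewrite mulr_ge0 ?subr_ge0 ?(ltW c0)// (le_trans wz).
  by lra.
have : (1 - z) * c <= (1 - w) * c by rewrite ler_wpM2r ?lerB// ltW.
have : 0 <= w * g t by rewrite mulr_ge0 ?(ltW g0)// (le_trans y0).
by lra.
Qed.

(* The Gaussian moment E exp(kappa Y^2 / 2) = (1 - kappa)^(-1/2) of a null
   coordinate is compensated by the slab weight c because
   c^2 = 1 / (1 + kappa sigma^2) <= 1 - kappa. *)
Lemma integral_scaled_factor_le1 (m w : R) : kappa < 1 ->
  1 <= sigma ^+ 2 * (1 - kappa) ->
  (\int[normal_law m 1]_y (scaled_factor (m == 0) y w)%:E <= 1)%E.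
Proof.
move=> k1 sk.
have int1 (r : R) : (\int[normal_law m 1]_y r%:E = r%:E)%E.
  rewrite integral_cst// -[RHS]mule1; congr (_ * _)%E.
  exact: (@probability_setT _ _ _ (normal_law m 1)).
have [m0|mn0] := eqVneq m 0; last first.
  rewrite -(int1 1); apply: ge0_le_integral_nomeas => y; rewrite lee_fin.
    exact: scaled_factor_ge0.
  by rewrite /scaled_factor divr1 marginal_factor_le1.
have [w01|w01] := boolP (0 <= w <= 1); last first.
  (* Outside [[0, 1]] the dummy value is the spike itself, and scaling turns it into 1. *)
  under eq_integral.
    move=> y _; rewrite /scaled_factor /marginal_factor (negbTE w01).
    rewrite divff ?gt_eqF ?expR_gt0//; over.
  by rewrite int1.
have /andP[w0 w1] := w01.
have c0 := slab_weight_gt0 kappa sigma kappa0 sigma0.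
have wc0 : 0 <= (1 - w) * c by rewrite mulr_ge0 ?subr_ge0// ltW.
have mh : measurable_fun setT
    (fun y : R => (expR (- (- kappa * (y - m) ^+ 2 / 2)))%:E).
  apply/measurable_EFinP; apply: measurableT_comp => //.
  apply: measurableT_comp => //; do 2 apply: measurable_funM => //.
  by apply: measurable_funX; exact: measurable_funB.
under eq_integral.
  move=> y _; rewrite /scaled_factor /marginal_factor w01 mulrDl.
  rewrite mulfK ?gt_eqF ?expR_gt0// -expRN.
  (* As [m = 0], the inverse spike is the integrand of [integral_normal_law_expR] at parameter
     [- kappa], admissible because [kappa < 1]. *)
  rewrite (_ : - - _ = - (- kappa * (y - m) ^+ 2 / 2)); last first.
    by rewrite m0 subr0; ring.
  rewrite EFinD [X in (_ + X)%E]EFinM; over.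
rewrite ge0_integralD//=; last 2 first.
- by move=> y _; rewrite -EFinM lee_fin mulr_ge0 ?expR_ge0.
- exact: measurable_funeM.
rewrite ge0_integralZl//= int1.
rewrite integral_normal_law_expR//; last by rewrite expr1n invr1; lra.
rewrite -EFinM -EFinD lee_fin expr1n invr1 mul1r.
have h : c / Num.sqrt (- kappa + 1) <= 1.
  rewrite /slab_weight -invfM invf_le1; last first.
    rewrite mulr_gt0 ?sqrtr_gt0//; last by lra.
    by rewrite mulr_gt0// sqrtr_gt0 addr_gt0 ?invr_gt0 ?exprn_gt0.
  rewrite -[X in X * _ * _]gtr0_norm// -sqrtr_sqr -sqrtrM ?sqr_ge0// -sqrtrM; last first.
    by rewrite mulr_ge0 ?sqr_ge0// addr_ge0 ?invr_ge0 ?sqr_ge0// ltW.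
  rewrite -[leLHS]sqrtr1 ler_wsqrtr//.
  have -> : sigma ^+ 2 * (kappa + sigma ^- 2) * (- kappa + 1) =
      1 + kappa * (sigma ^+ 2 * (1 - kappa) - 1) by field; rewrite gt_eqF.
  by rewrite lerDl mulr_ge0 ?subr_ge0// ltW.
have : (1 - w) * (c / Num.sqrt (- kappa + 1)) <= (1 - w) * 1.
  by rewrite ler_wpM2l// subr_ge0.
by rewrite mulr1 mulrA; lra.
Qed.

(** * Numerator and denominator of the posterior of omega *)

Section posterior.
Variables (n : nat) (alpha : R) (theta : n.-tuple R).
Let null (i : 'I_n) := tnth theta i == 0.

Definition scaled_mass (x : n.-tuple R) (A : set R) : \bar R :=
  (\int[beta1_prob (alpha * n%:R)]_(w in A)
     (\prod_(i < n) scaled_factor (null i) (tnth x i) w)%:E)%E.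

Lemma measurable_prod_scaled_factor :
  measurable_fun setT (fun p : n.-tuple R * R =>
    \prod_(i < n) scaled_factor (null i) (tnth p.1 i) p.2).
Proof.
apply: measurable_prod => i _.
have mi : measurable_fun setT (fun p : n.-tuple R * R => (tnth p.1 i, p.2)).
  apply: measurable_fun_pair => //=.
  by apply: (measurableT_comp (measurable_tnth i)).
exact: (measurableT_comp (measurable_scaled_factor (null i)) mi).
Qed.

Lemma measurable_scaled_mass_integrand x :
  measurable_fun setT (fun w : R =>
    \prod_(i < n) scaled_factor (null i) (tnth x i) w).
Proof.
have mx : measurable_fun setT (fun w : R => (x, w)) by exact: measurable_fun_pair.
exact: (measurableT_comp measurable_prod_scaled_factor mx).
Qed.

Lemma prod_scaled_factor_ge0 x w :
  0 <= \prod_(i < n) scaled_factor (null i) (tnth x i) w.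
Proof. by apply: prodr_ge0 => i _; exact: scaled_factor_ge0. Qed.

(** The weight differs from the scaled mass by [P * G], which is positive and independent of the
    set, so it cancels in the ratio. *)
Lemma posterior_scaledE x (A : set R) : measurable A ->
  posterior alpha kappa sigma x (snd @^-1` A) =
  fine (scaled_mass x A) / fine (scaled_mass x setT).
Proof.
move=> mA.
pose G := \prod_(i < n) (if null i then g (tnth x i) else 1).
have G0 : 0 < G by apply: prodr_gt0 => i _; case: ifP; rewrite ?expR_gt0.
pose P := normal_peak 1 `^ kappa ^+ n.
have P0 : 0 < P :> R by rewrite exprn_gt0// powR_gt0// normal_peak_gt0 ?oner_eq0.
have wE B : measurable B ->
    fine (posterior_weight alpha kappa sigma x (snd @^-1` B)) =
    P * G * fine (scaled_mass x B).
  move=> mB; rewrite posterior_weightE// -/P.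
  have -> : (\int[beta1_prob (alpha * n%:R)]_(w in B)
     (\prod_(i < n) marginal_factor kappa sigma (tnth x i) w)%:E =
     G%:E * scaled_mass x B)%E.
    rewrite /scaled_mass -ge0_integralZl//; last 3 first.
    - apply/measurable_EFinP/measurable_funTS.
      exact: measurable_scaled_mass_integrand.
    - by move=> w _; rewrite lee_fin prod_scaled_factor_ge0.
    - by rewrite lee_fin ltW.
    apply: eq_integral => w _; rewrite -EFinM -big_split/=; congr EFin.
    apply: eq_bigr => i _; rewrite /scaled_factor mulrC divfK//.
    by case: ifP; rewrite ?gt_eqF ?expR_gt0.
  rewrite muleA -EFinM.
  have PG0 : 0 < P * G by exact: mulr_gt0.
  (* An infinite mass stays infinite under a positive multiple, and [fine] sends it to 0 on both
     sides. *)
  by case: (scaled_mass x B) => [r| |] //=; rewrite ?gt0_muley ?gt0_muleNy ?mulr0.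
rewrite /posterior wE// -[in X in _ / X](preimage_setT snd) wE//.
by rewrite -mulf_div divff ?mul1r// mulf_neq0// gt_eqF.
Qed.

Lemma scaled_mass_ge0 x A : (0 <= scaled_mass x A)%E.
Proof.
by apply: integral_ge0 => w _; rewrite lee_fin prod_scaled_factor_ge0.
Qed.

(** The indicator is moved into the integrand so that Tonelli applies on the full product space. *)
Let integrand (A : set R) (p : n.-tuple R * R) : \bar R :=
  (\1_A p.2 * \prod_(i < n) scaled_factor (null i) (tnth p.1 i) p.2)%:E.

Let integrand_ge0 A p : (0 <= integrand A p)%E.
Proof. by rewrite lee_fin mulr_ge0// prod_scaled_factor_ge0. Qed.

Let measurable_integrand A : measurable A -> measurable_fun setT (integrand A).
Proof.
move=> mA; apply/measurable_EFinP/measurable_funM; last first.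
  exact: measurable_prod_scaled_factor.
exact: (measurableT_comp (measurable_indic mA)).
Qed.

Let scaled_massE x A : scaled_mass x A =
  (\int[beta1_prob (alpha * n%:R)]_w integrand A (x, w))%E.
Proof.
rewrite /scaled_mass integral_mkcond; apply: eq_integral => w _.
by rewrite patchE /integrand/= indicE; case: ifP; rewrite ?mul1r ?mul0r.
Qed.

Lemma measurable_scaled_mass A : measurable A ->
  measurable_fun setT (fun x => scaled_mass x A).
Proof.
move=> mA; under eq_fun do rewrite scaled_massE.
apply: measurable_fun_fubini_tonelli_F => //; exact: measurable_integrand.
Qed.

(** Tonelli puts the expectation over the data inside; for fixed [w] it is a product of means, each
    at most 1. *)
Lemma integral_scaled_mass_le (A : set R) : kappa < 1 ->
  1 <= sigma ^+ 2 * (1 - kappa) -> measurable A ->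
  (\int[data_law theta]_x scaled_mass x A <= beta1_prob (alpha * n%:R) A)%E.
Proof.
move=> k1 sk mA.
under eq_integral do rewrite scaled_massE.
rewrite fubini_tonelli//; last exact: measurable_integrand.
rewrite [leRHS](_ : _ = \int[beta1_prob (alpha * n%:R)]_(w in A) 1)%E; last first.
  by rewrite integral_cst// mul1e.
rewrite [leRHS]integral_mkcond; apply: ge0_le_integral_nomeas => w.
  exact: integral_ge0.
rewrite patchE /integrand/= indicE; case: ifP => wA; last first.
  by under eq_integral do rewrite mul0r; rewrite integral0.
under eq_integral do rewrite mul1r.
rewrite (@integral_prod_prob _ _ R n _ (fun i y => scaled_factor (null i) y w)).
- have : (forall i, 0 <= \int[normal_law (tnth theta i) 1]_y
      (scaled_factor (null i) y w)%:E <= 1)%E.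
    move=> i; rewrite integral_scaled_factor_le1// andbT.
    by apply: integral_ge0 => y _; rewrite lee_fin scaled_factor_ge0.
  move=> h.
  suff /andP[] : (0 <= \prod_(i < n) \int[normal_law (tnth theta i) 1]_y
    (* Nonnegativity travels with the upper bound through the product, since multiplying
       inequalities requires it. *)
    (scaled_factor (null i) y w)%:E <= 1)%E by [].
  elim/big_ind: _ => [|a b /andP[a0 a1] /andP[b0 b1]|i _]; last exact: h.
    by rewrite lee01 lexx.
  by rewrite mule_ge0//= -[leRHS]mule1 lee_pmul.
- by move=> i y; exact: scaled_factor_ge0.
- move=> i.
  have mw : measurable_fun setT (fun y : R => (y, w)) by exact: measurable_fun_pair.
  exact: (measurableT_comp (measurable_scaled_factor (null i)) mw).
Qed.

(** Restricting [w] to [[y, z]] bounds every factor below for all data at once, so no exceptional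
    event has to be removed. *)
Lemma scaled_mass_ge s x (y z : R) : sparse theta s -> 0 < alpha * n%:R ->
  0 < y -> y < z -> z < 1 ->
  ((y ^+ n * ((1 - z) * c) ^+ s *
    (z `^ (alpha * n%:R) - y `^ (alpha * n%:R)))%:E <= scaled_mass x setT)%E.
Proof.
move=> /eqP thetas an0 y0 yz z1.
have c0 := slab_weight_gt0 kappa sigma kappa0 sigma0.
have zc0 : 0 <= (1 - z) * c by rewrite mulr_ge0 ?subr_ge0// ltW.
pose l i := if null i then y else (1 - z) * c.
have l0 i : 0 <= l i by rewrite /l; case: ifP; rewrite ?(ltW y0).
(* The null coordinates number at most [n] and [y < 1], so [y ^+ n] bounds their product from
   below. *)
have lE : y ^+ n * ((1 - z) * c) ^+ s <= \prod_(i < n) l i.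
  rewrite /l big_if/= !prodr_const thetas ler_wpM2r ?exprn_ge0//.
  by rewrite ler_wiXn2l ?(ltW y0) ?(ltW (lt_trans yz z1))// -[leqRHS]card_ord max_card.
apply: (@le_trans _ _ (\int[beta1_prob (alpha * n%:R)]_(w in `[y, z])
    (\prod_(i < n) l i)%:E)%E).
  rewrite integral_cst//= EFinM.
  apply: (@le_trans _ _ ((y ^+ n * ((1 - z) * c) ^+ s)%:E *
      beta1_prob (alpha * n%:R) `[y, z])%E).
    rewrite lee_wpmul2l ?beta1_prob_itv_ge// lee_fin.
    by rewrite mulr_ge0 ?exprn_ge0 ?(ltW y0).
  by rewrite lee_wpmul2r ?lee_fin.
apply: (@le_trans _ _ (scaled_mass x `[y, z])); last first.
  apply: ge0_subset_integral => //.
    by apply/measurable_EFinP; exact: measurable_scaled_mass_integrand.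
  by move=> w _; rewrite lee_fin prod_scaled_factor_ge0.
apply: ge0_le_integral => //.
- by move=> w _; rewrite lee_fin prodr_ge0.
- apply/measurable_EFinP/measurable_funTS.
  exact: measurable_scaled_mass_integrand.
- move=> w /=; rewrite in_itv/= => wyz; rewrite lee_fin.
  apply: ler_prod => i _; rewrite l0/=.
  by apply: scaled_factor_itv_ge; rewrite ?(ltW y0) ?(ltW z1).
Qed.

(** A deterministic lower bound [d] on the denominator leaves only the numerator to be averaged. *)
Lemma expectation_posterior_le d (A : set R) : kappa < 1 ->
  1 <= sigma ^+ 2 * (1 - kappa) -> measurable A -> 0 < d ->
  (forall x, d%:E <= scaled_mass x setT)%E ->
  ('E_(data_law theta)[fun x => posterior alpha kappa sigma x (snd @^-1` A)] <=
   d^-1%:E * beta1_prob (alpha * n%:R) A)%E.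
Proof.
move=> k1 sk mA d0 dle.
have fine0 x B : 0 <= fine (scaled_mass x B) by rewrite fine_ge0 ?scaled_mass_ge0.
apply: (@le_trans _ _ (\int[data_law theta]_x (d^-1%:E * scaled_mass x A))%E).
  rewrite unlock; apply: ge0_le_integral_nomeas => x; rewrite posterior_scaledE//.
    by rewrite lee_fin divr_ge0.
  rewrite mulrC EFinM; apply: lee_pmul; rewrite ?lee_fin ?invr_ge0//.
    have := dle x; case: (scaled_mass x setT) => [r| |] //=.
    - by rewrite lee_fin => dr; rewrite lef_pV2// posrE (lt_le_trans d0).
    (* At infinite mass [fine] gives 0, whose inverse is 0 by convention, still below [d^-1]. *)
    - by move=> _; rewrite invr0 invr_ge0 ltW.
  have := scaled_mass_ge0 x A; case: (scaled_mass x A) => [r| |] //=.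
rewrite ge0_integralZl//.
- by rewrite lee_wpmul2l ?integral_scaled_mass_le// lee_fin invr_ge0 ltW.
- exact: measurable_scaled_mass.
- by move=> x _; exact: scaled_mass_ge0.
- by rewrite lee_fin invr_ge0 ltW.
Qed.

End posterior.
End scaled_factor.

(** * Convergence of the expected posterior tail *)

Theorem theorem3 (R : realType) (alpha beta kappa sigma : R)
    (s : nat -> nat) (theta : forall n : nat, n.-tuple R)
    (alpha_gt0 : 0 < alpha) (beta_gt1 : 1 < beta)
    (kappa01 : 0 < kappa < 1) (sigma_gt0 : 0 < sigma)
    (region : in_region beta kappa (sigma ^+ 2))
    (theta_sparse : forall n, sparse (theta n) (s n))
    (s_oo : (s n)%:R @[n --> \oo] --> (+oo : set_system R))
    (s_small : (s n)%:R / n%:R @[n --> \oo] --> (0 : R)) :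
  exists K0 : R, forall K : R, K0 < K ->
    'E_(data_law (theta n))[fun x : n.-tuple R =>
      posterior alpha kappa sigma x
        [set z : n.-tuple R * R | (1 - z.2 > K * eps (s n) n / n%:R)%R]]%E
      @[n --> \oo] --> 0%E.
Proof.
have /andP[kappa0 kappa1] := kappa01.
have sk := in_region_ge1 _ _ _ beta_gt1 kappa01 (exprn_gt0 _ sigma_gt0) region.
exists (2 / alpha) => K; rewrite ltr_pdivrMr// mulrC => aK.
pose c := slab_weight kappa sigma.
have c0 : 0 < c by exact: slab_weight_gt0.
apply: (@squeeze_cvge _ _ _ _ (fun=> 0%E) _ (fun n => (2 * expR (- (s n)%:R))%:E)).
- near=> n.
  have s2 : 2 <= alpha * (s n)%:R.
    rewrite -ler_pdivrMl//; near: n.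
    by move/cvgryPge: s_oo; apply.
  have s0 : (0 < s n)%N.
    by rewrite lt0n; apply/negP => /eqP sn0; move: s2; rewrite sn0; lra.
  have sR0 : (0 : R) < (s n)%:R by rewrite ltr0n.
  have n0 : (0 < n)%N by near: n; exact: nbhs_infty_gt.
  have nR0 : (0 : R) < n%:R by rewrite ltr0n.
  have x0 : 0 < (s n)%:R / n%:R :> R by rewrite divr_gt0.
  have x1 : (s n)%:R / n%:R <= 1 / 2 :> R.
    rewrite -[leLHS]ger0_norm ?(ltW x0)//; near: n.
    by move/cvgr0Pnorm_le: s_small; apply; rewrite divr_gt0.
  (* Exponentiating and inverting turns this into smallness of s/n. *)
  have Lge : 3 + alpha - ln (c / 2) <= ln (n%:R / (s n)%:R).
    rewrite -ler_expR lnK ?posrE ?divr_gt0// -[leRHS]invf_div.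
    rewrite -[leLHS]invrK lef_pV2 ?posrE ?invr_gt0 ?expR_gt0//.
    rewrite -[leLHS]ger0_norm ?(ltW x0)//; near: n.
    by move/cvgr0Pnorm_le: s_small; apply; rewrite invr_gt0 expR_gt0.
  have := @tail_ratio_le R alpha c K n (s n) alpha_gt0 c0 aK n0 s0 x1 s2 Lge.
  move=> /=; set y := 1 - (s n)%:R / n%:R; set z := 1 - (s n)%:R / (2 * n%:R).
  (* This [d] is the deterministic denominator bound of [scaled_mass_ge]. *)
  set d := _ * (_ - _) => le_ratio.
  have an0 : 0 < alpha * n%:R by exact: mulr_gt0.
  have xE : (s n)%:R / (2 * n%:R) = (s n)%:R / n%:R / 2 :> R.
    by field; rewrite gt_eqF.
  have y0 : 0 < y by rewrite /y; lra.
  have yz : y < z by rewrite /y /z xE; lra.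
  have z1 : z < 1 by rewrite /z xE; lra.
  have d0 : 0 < d.
    rewrite !mulr_gt0 ?exprn_gt0 ?mulr_gt0 ?subr_gt0//; first by lra.
    by rewrite gt0_ltr_powR ?nnegrE ?(ltW y0) ?(ltW (lt_trans y0 yz)).
  set u := K * eps (s n) n / n%:R.
  apply/andP; split.
    rewrite unlock; apply: integral_ge0 => x _; rewrite lee_fin.
    by rewrite divr_ge0// fine_ge0// integral_ge0// => t _; rewrite lee_fin powR_ge0.
  have u0 : 0 < u.
    have K0 : 0 < K by rewrite -(pmulr_rgt0 _ alpha_gt0); lra.
    rewrite divr_gt0// mulr_gt0// mulr_gt0// ln_gt0//.
    by rewrite -[ltRHS]invf_div invf_gt1//; lra.
  have mA : measurable [set w : R | 1 - w > u].
    rewrite -[X in measurable X]setTI; apply: measurable_fun_ltr => //.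
    exact: measurable_funB.
  apply: le_trans (@expectation_posterior_le R kappa sigma kappa0 sigma_gt0 n
    alpha (theta n) d [set w : R | 1 - w > u] kappa1 sk mA d0 _) _.
    move=> x; apply: scaled_mass_ge => //; exact: theta_sparse.
  apply: (@le_trans _ _ (d^-1%:E * (expR (- (alpha * n%:R * u)))%:E)%E).
    by rewrite lee_wpmul2l ?beta1_prob_upper_tail// lee_fin invr_ge0 ltW.
  by rewrite -EFinM lee_fin mulrC.
- exact: cvg_cst.
- apply: cvg_EFin; first exact: nearW.
  rewrite -[X in _ --> X](mulr0 2); apply: cvgMr.
  exact: (cvg_comp _ _ s_oo (@cvgr_expR R)).
Unshelve. all: end_near. Qed.
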